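(* Let $X_Q=V(r^2-qs)\subset\mathbb{C}^4$ and for $d\in\mathbb{N}$ let $g_d:X_Q\to X_Q$ be the Chebyshev-induced morphism on $\mathbb{C}^3/D_4\simeq X_Q$. Let $L_2=V(p,r,s)=\{(0,q,0,0):q\in\mathbb{C}\}$. (1) If $d$ is odd then $g_d(L_2)=L_2$; in particular $g_d(0,t^2,0,0)=(0,T_d(t)^2,0,0)$. (2) $g_2(L_2)=C_2$, where $C_2=V(-64+16q-8r+s,\ -8p+4r-s,\ 16r^2-64s-8rs+s^2)$; $C_2$ is an affine algebraic curve and has the polynomial parametric representation $G_2(T)=(4T,\ (T+2)^2,\ 4T(T+2),\ 16T^2)$. (3) $g_d(C_2)=C_2$ for every $d\ge1$; in particular $g_d(G_2(t^2))=G_2(T_d(t)^2)$ for all $t\in\mathbb{C}$.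
   Context: $\mathbb{N}=\{1,2,\dots\}$. $T_d(z)$ is the one-variable Chebyshev polynomial with $T_d(s+s^{-1})=s^d+s^{-d}$. An affine algebraic curve is an irreducible algebraic set of dimension 1; a polynomial parametric representation of an algebraic set $V\subset\mathbb{C}^4$ is a polynomial map into $\mathbb{C}^4$ such that $V$ is the smallest algebraic set containing its image. Definition of $g_d$: the Chebyshev endomorphism $P_{A_3}^d:\mathbb{C}^3\to\mathbb{C}^3$ is defined by $P_{A_3}^d(e_1(t),e_2(t),e_3(t))=(e_1(t^d),e_2(t^d),e_3(t^d))$ for $t=(t_1,t_2,t_3,t_4)\in(\mathbb{C}^* )^4$ with $t_1t_2t_3t_4=1$, where $t^d=(t_1^d,\dots,t_4^d)$ and $e_j$ is the $j$-th elementary symmetric polynomial. With $M_3(x,y,z)=(x+iy,\,z,\,x-iy)$ put $f_d=M_3^{-1}\circ P_{A_3}^d\circ M_3$. $D_4\subset GL(3,\mathbb{R})$ is the dihedral group of order 8 generated by $(x,y,z)\mapsto(-y,x,-z)$ and $(x,y,z)\mapsto(x,-y,z)$. The map $\tilde F(x,y,z)=(x^2+y^2,\,z^2,\,z(x^2-y^2),\,(x^2-y^2)^2)$ from $\mathbb{C}^3$ onto $X_Q$ (coordinates $(p,q,r,s)$) induces a bijection $\mathbb{C}^3/D_4\simeq X_Q$, and $g_d:X_Q\to X_Q$ is the unique map with $g_d\circ\tilde F=\tilde F\circ f_d$ (it is a morphism). *)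

(* Defs.v *)
From mathcomp Require Import all_boot all_order all_algebra.
From mathcomp Require Import boolp classical_sets reals.
From mathcomp Require Import complex mpoly.
From mathcomp Require Import ring.

Set Implicit Arguments.
Unset Strict Implicit.
Unset Printing Implicit Defensive.

Import Order.TTheory GRing.Theory Num.Theory.

Local Open Scope classical_set_scope.
Local Open Scope ring_scope.

(* Points of C^n are n-tuples. The definitions make sense over any
   numClosedFieldType C; the theorem uses C = CC R, the complex numbers. *)

Definition CC (R : realType) : numClosedFieldType := R[i].

Section AlgebraicSets.
Variable C : numClosedFieldType.
Implicit Types n m : nat.

Definition zeros n (S : set {mpoly C[n]}) : set (n.-tuple C) :=
  [set v | forall f, S f -> f.@[tnth v] = 0].

Definition algebraic n (V : set (n.-tuple C)) : Prop := exists S, V = zeros S.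

Definition irreducible n (V : set (n.-tuple C)) : Prop :=
  [/\ algebraic V, V !=set0 &
      forall A B, algebraic A -> algebraic B ->
        V = A `|` B -> V = A \/ V = B].

(* Z 0 < Z 1 < ... < Z k, irreducible algebraic subsets of V *)
Definition has_chain n (V : set (n.-tuple C)) (k : nat) : Prop :=
  exists Z : nat -> set (n.-tuple C),
    (forall i, (i <= k)%N -> irreducible (Z i) /\ Z i `<=` V) /\
    (forall i, (i < k)%N -> Z i `<` Z i.+1).

Definition has_dim n (V : set (n.-tuple C)) (k : nat) : Prop :=
  has_chain V k /\ ~ has_chain V k.+1.

Definition affine_algebraic_curve n (V : set (n.-tuple C)) : Prop :=
  irreducible V /\ has_dim V 1.

Definition polynomial_map m n (G : m.-tuple C -> n.-tuple C) : Prop :=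
  exists ps : n.-tuple {mpoly C[m]},
    forall u i, tnth (G u) i = (tnth ps i).@[tnth u].

Definition polynomial_param m n (G : m.-tuple C -> n.-tuple C)
    (V : set (n.-tuple C)) : Prop :=
  [/\ polynomial_map G, algebraic V, range G `<=` V &
      forall W, algebraic W -> range G `<=` W -> V `<=` W].

End AlgebraicSets.

Section Chebyshev.
Variable C : numClosedFieldType.

Lemma exists_chebT (d : nat) : exists p : {poly C},
  forall s, s != 0 -> p.[s + s^-1] = s ^+ d + s ^- d.
Proof.
suff [p [_ [? _]]] : exists p q : {poly C},
    (forall s, s != 0 -> p.[s + s^-1] = s ^+ d + s ^- d) /\
    (forall s, s != 0 -> q.[s + s^-1] = s ^+ d.+1 + s ^- d.+1) by exists p.
elim: d => [|d [p [q [Hp Hq]]]].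
  exists 2%:P, 'X; split=> s s0; first by rewrite hornerC expr0 invr1.
  by rewrite hornerX expr1.
exists q, ('X * q - p); split=> // s s0.
rewrite hornerD hornerN hornerM hornerX Hp // Hq // !exprS.
have sd0 : s ^+ d != 0 by rewrite expf_neq0.
by field; rewrite s0 sd0.
Qed.

Definition chebT (d : nat) : {poly C} := sval (cid (exists_chebT d)).

Lemma chebTE (d : nat) (s : C) :
  s != 0 -> (chebT d).[s + s^-1] = s ^+ d + s ^- d.
Proof. by move=> s0; exact: (svalP (cid (exists_chebT d))). Qed.

End Chebyshev.

Section ChebyshevA3.
Variable C : numClosedFieldType.

Definition esym123 (t : 4.-tuple C) : 3.-tuple C :=
  [tuple (mesym 4 C 1).@[tnth t]; (mesym 4 C 2).@[tnth t];
         (mesym 4 C 3).@[tnth t]].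

Definition tpow (d : nat) (t : 4.-tuple C) : 4.-tuple C :=
  map_tuple (fun x => x ^+ d) t.

(* The condition forces every t_i to be nonzero. *)
Definition torus (t : 4.-tuple C) : Prop := \prod_(i < 4) tnth t i = 1.

Lemma tuple4_eta (t : 4.-tuple C) : exists a b c e, t = [tuple a; b; c; e].
Proof.
case: t => [[|a [|b [|c [|e [|]]]]] //= h]; exists a, b, c, e.
exact: val_inj.
Qed.

Lemma tuple3_eta (t : 3.-tuple C) : exists a b c, t = [tuple a; b; c].
Proof.
case: t => [[|a [|b [|c [|]]]] //= h]; exists a, b, c.
exact: val_inj.
Qed.

Lemma torusE (a b c e : C) : torus [tuple a; b; c; e] <-> a * b * c * e = 1.
Proof. by rewrite /torus !big_ord_recl big_ord0 /= mulr1 !mulrA. Qed.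

Let quartic (e1 e2 e3 e4 : C) : {poly C} :=
  'X^4 - e1%:P * 'X^3 + e2%:P * 'X^2 - e3%:P * 'X + e4%:P.

Let quartic_coef e1 e2 e3 e4 :
  (((quartic e1 e2 e3 e4)`_0 = e4) * ((quartic e1 e2 e3 e4)`_1 = - e3) *
   ((quartic e1 e2 e3 e4)`_2 = e2) * ((quartic e1 e2 e3 e4)`_3 = - e1))%type.
Proof. by do !split; rewrite /quartic !coefE /=; ring. Qed.

Let prod4 (a b c e : C) : \prod_(x <- [tuple a; b; c; e]) ('X - x%:P) =
  quartic (a + b + c + e) (a*b + a*c + a*e + b*c + b*e + c*e)
          (a*b*c + a*b*e + a*c*e + b*c*e) (a*b*c*e).
Proof.
rewrite /quartic /= !big_cons big_nil !(rmorphD, rmorphM) /=; ring.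
Qed.

Lemma esym123E (a b c e : C) : esym123 [tuple a; b; c; e] =
  [tuple a + b + c + e; a*b + a*c + a*e + b*c + b*e + c*e;
         a*b*c + a*b*e + a*c*e + b*c*e].
Proof.
set t := [tuple a; b; c; e].
have H (k : 'I_5) : (mesym 4 C k).@[tnth t] =
    (-1) ^+ k * (\prod_(x <- t) ('X - x%:P))`_(4 - k).
  by rewrite mroots_coeff signrMK.
have := (H (@Ordinal 5 1 isT), H (@Ordinal 5 2 isT), H (@Ordinal 5 3 isT)).
rewrite /= /esym123 => -[[-> ->] ->]; rewrite prod4 !subSS !subn0.
rewrite !quartic_coef.
by apply: val_inj => /=; congr [:: _; _; _]; ring.
Qed.

Lemma esym123_tpow (d : nat) (t t' : 4.-tuple C) : torus t -> torus t' ->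
  esym123 t = esym123 t' -> esym123 (tpow d t) = esym123 (tpow d t').
Proof.
move=> tt tt' et.
have pe : perm_eq t t'.
  apply: prod_XsubC_eq; move: tt tt' et.
  have [a [b [c [e ->]]]] := tuple4_eta t.
  have [a' [b' [c' [e' ->]]]] := tuple4_eta t'.
  rewrite !torusE !esym123E !prod4 => -> -> /(congr1 val)[-> -> ->].
  by [].
have pd : perm_eq (tpow d t) (tpow d t') by exact: perm_map.
have H k : (k < 5)%N -> (mesym 4 C k).@[tnth (tpow d t)] =
    (mesym 4 C k).@[tnth (tpow d t')].
  move=> k5; apply: (mulrI (unitrX k (unitrN1 C))).
  by rewrite -!(mroots_coeff _ (Ordinal k5)) (perm_big _ pd).
by rewrite /esym123 !H.
Qed.

Lemma esym123_surj (v : 3.-tuple C) : exists2 t, torus t & esym123 t = v.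
Proof.
have [e1 [e2 [e3 ->]]] := tuple3_eta v.
pose q := Poly [:: 1; - e3; e2; - e1].
have sq : (size q < size ('X^4 : {poly C}))%N.
  by rewrite size_polyXn ltnS; exact: size_Poly.
have qE : quartic e1 e2 e3 1 = 'X^4 + q.
  rewrite /quartic /q /= !cons_poly_def !rmorphN /=; ring.
have [r] := closed_field_poly_normal (quartic e1 e2 e3 1).
have -> : lead_coef (quartic e1 e2 e3 1) = 1.
  by rewrite qE lead_coefDl // lead_coefXn.
rewrite scale1r => Er.
have sr : size r == 4%N.
  have := size_prod_XsubC r id; rewrite -Er qE size_polyDl // size_polyXn.
  by case=> <-.
have [a [b [c [e Et]]]] := tuple4_eta (Tuple sr).
have {}Er : quartic e1 e2 e3 1 = \prod_(x <- [tuple a; b; c; e]) ('X - x%:P).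
  by rewrite -Et.
exists [tuple a; b; c; e].
  apply/torusE; have := congr1 (fun p : {poly C} => p`_0) Er.
  by rewrite prod4 !quartic_coef.
rewrite esym123E; apply: val_inj => /=.
have := congr1 (fun p : {poly C} => (p`_1, p`_2, p`_3)) Er; rewrite prod4.
by rewrite !quartic_coef => -[] /oppr_inj -> -> /oppr_inj ->.
Qed.

Lemma exists_chebA3 (d : nat) : exists P : 3.-tuple C -> 3.-tuple C,
  forall t, torus t -> P (esym123 t) = esym123 (tpow d t).
Proof.
pose pt v := s2val (cid2 (esym123_surj v)).
exists (fun v => esym123 (tpow d (pt v))) => t tt.
by apply: esym123_tpow => //; rewrite /pt; case: cid2.
Qed.

Definition chebA3 (d : nat) : 3.-tuple C -> 3.-tuple C :=
  sval (cid (exists_chebA3 d)).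

Lemma chebA3E (d : nat) (t : 4.-tuple C) :
  torus t -> chebA3 d (esym123 t) = esym123 (tpow d t).
Proof. exact: (svalP (cid (exists_chebA3 d))). Qed.

Lemma chebA3_unique (d : nat) (P : 3.-tuple C -> 3.-tuple C) :
  (forall t, torus t -> P (esym123 t) = esym123 (tpow d t)) -> P = chebA3 d.
Proof.
move=> HP; apply: funext => v; have [t tt <-] := esym123_surj v.
by rewrite HP // chebA3E.
Qed.

End ChebyshevA3.

Section QuotientMap.
Variable C : numClosedFieldType.

Definition M3 (v : 3.-tuple C) : 3.-tuple C :=
  let x := v`_0 in let y := v`_1 in let z := v`_2 in
  [tuple x + 'i * y; z; x - 'i * y].

Definition M3inv (w : 3.-tuple C) : 3.-tuple C :=
  let a := w`_0 in let b := w`_1 in let c := w`_2 in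
  [tuple (a + c) / 2; (a - c) / (2 * 'i); b].

Let i0 : 'i != 0 :> C. Proof. exact: neq0Ci. Qed.
Let n2 : 2 != 0 :> C. Proof. by rewrite pnatr_eq0. Qed.

Lemma M3K : cancel M3 M3inv.
Proof.
move=> v; have [x [y [z ->]]] := tuple3_eta v; apply: val_inj => /=.
by congr [:: _; _; _]; field; rewrite ?i0.
Qed.

Lemma M3invK : cancel M3inv M3.
Proof.
move=> v; have [x [y [z ->]]] := tuple3_eta v; apply: val_inj => /=.
by congr [:: _; _; _]; field; rewrite ?i0.
Qed.

Definition fd (d : nat) (v : 3.-tuple C) : 3.-tuple C :=
  M3inv (chebA3 d (M3 v)).

Definition Ftilde (v : 3.-tuple C) : 4.-tuple C :=
  let x := v`_0 in let y := v`_1 in let z := v`_2 in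
  [tuple x ^+ 2 + y ^+ 2; z ^+ 2; z * (x ^+ 2 - y ^+ 2);
         (x ^+ 2 - y ^+ 2) ^+ 2].

Local Notation p := ('X_(@Ordinal 4 0 isT) : {mpoly C[4]}).
Local Notation q := ('X_(@Ordinal 4 1 isT) : {mpoly C[4]}).
Local Notation r := ('X_(@Ordinal 4 2 isT) : {mpoly C[4]}).
Local Notation s := ('X_(@Ordinal 4 3 isT) : {mpoly C[4]}).

Definition XQ : set (4.-tuple C) := zeros [set r ^+ 2 - q * s].

Definition L2 : set (4.-tuple C) := zeros [set p; r; s].

Definition C2 : set (4.-tuple C) :=
  zeros [set - 64 + 16 * q - 8 * r + s;
             - 8 * p + 4 * r - s;
             16 * r ^+ 2 - 64 * s - 8 * r * s + s ^+ 2].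

Definition G2 (T : C) : 4.-tuple C :=
  [tuple 4 * T; (T + 2) ^+ 2; 4 * T * (T + 2); 16 * T ^+ 2].

Lemma XQE : XQ = [set w | w`_2 ^+ 2 = w`_1 * w`_3].
Proof.
apply/seteqP; split=> w; have [a [b [c [e ->]]]] := tuple4_eta w => /=.
  move=> /(_ _ erefl); rewrite expr2 !(mevalB, mevalM, mevalXU) /=.
  by rewrite !(tnth_nth 0) /= -expr2 => /subr0_eq.
move=> E _ ->; rewrite expr2 !(mevalB, mevalM, mevalXU) !(tnth_nth 0) /=.
by rewrite -expr2 E subrr.
Qed.

Lemma L2E : L2 = [set [tuple 0; x; 0; 0] | x in setT].
Proof.
apply/seteqP; split=> w.
  have [a [b [c [e ->]]]] := tuple4_eta w => H; exists b => //.
  have := (H p (or_introl (or_introl erefl)),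
           H r (or_introl (or_intror erefl)), H s (or_intror erefl)).
  by rewrite !mevalXU !(tnth_nth 0) /= => -[[-> ->] ->].
by case=> x _ <- _ [[]|] ->; rewrite mevalXU (tnth_nth 0).
Qed.

Lemma range_Ftilde : range Ftilde = XQ.
Proof.
rewrite XQE; apply/seteqP; split=> w /=.
  by case=> v _ <- /=; ring.
have [P [Q [S [U ->]]]] := tuple4_eta w => /= E.
have [u [z [zQ zS uU]]] : exists u z, [/\ z ^+ 2 = Q, z * u = S & u ^+ 2 = U].
  have [Q0|Q0] := eqVneq Q 0.
    exists (sqrtC U), 0; rewrite sqrtCK expr0n mul0r Q0; split=> //.
    by move/eqP: E; rewrite Q0 mul0r expf_eq0 => /eqP.
  have z0 : sqrtC Q != 0 by rewrite sqrtC_eq0.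
  exists (S / sqrtC Q), (sqrtC Q); rewrite sqrtCK; split=> //.
    by field.
  by rewrite expr_div_n sqrtCK E mulrC mulKf.
exists [tuple sqrtC ((P + u) / 2); sqrtC ((P - u) / 2); z] => //.
apply: val_inj; rewrite /Ftilde /= !sqrtCK zQ -zS -uU.
by congr [:: _; _; _; _]; field.
Qed.

(* Ftilde read in the coordinates given by M3 *)
Let H (w : 3.-tuple C) : 4.-tuple C :=
  let a := w`_0 in let b := w`_1 in let c := w`_2 in
  [tuple a * c; b ^+ 2; b * ((a ^+ 2 + c ^+ 2) / 2);
         ((a ^+ 2 + c ^+ 2) / 2) ^+ 2].

Let FM w : Ftilde (M3inv w) = H w.
Proof.
have [a [b [c ->]]] := tuple3_eta w; apply: val_inj => /=.
have -> : ((a - c) / (2 * 'i)) ^+ 2 = - (a - c) ^+ 2 / 4.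
  rewrite expr_div_n exprMn sqrCi mulrN1 invrN mulrN mulNr.
  by congr (- (_ * _^-1)); ring.
by congr [:: _; _; _; _]; field.
Qed.

(* Up to M3, the action of D_4 on C^3 is generated by scale and swap. *)
Let scale (u : C) (w : 3.-tuple C) : 3.-tuple C :=
  [tuple u * w`_0; u ^+ 2 * w`_1; u ^+ 3 * w`_2].
Let swap (w : 3.-tuple C) : 3.-tuple C := [tuple w`_2; w`_1; w`_0].

Let H_scale u w : u ^+ 4 = 1 -> H (scale u w) = H w.
Proof.
move=> u4; have [a [b [c ->]]] := tuple3_eta w; apply: val_inj => /=.
have -> : (u * a) ^+ 2 + (u ^+ 3 * c) ^+ 2 = u ^+ 2 * (a ^+ 2 + u ^+ 4 * c ^+ 2).
  by ring.
rewrite u4 mul1r; congr [:: _; _; _; _].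
- by transitivity (u ^+ 4 * (a * c)); [ring | rewrite u4 mul1r].
- by transitivity (u ^+ 4 * b ^+ 2); [ring | rewrite u4 mul1r].
- transitivity (u ^+ 4 * (b * ((a ^+ 2 + c ^+ 2) / 2))); last by rewrite u4 mul1r.
  by field.
- transitivity (u ^+ 4 * ((a ^+ 2 + c ^+ 2) / 2) ^+ 2); last by rewrite u4 mul1r.
  by field.
Qed.

Let H_swap w : H (swap w) = H w.
Proof. by apply: val_inj; rewrite /= (mulrC w`_2) (addrC (w`_2 ^+ 2)). Qed.

Let P_scale d u w : u ^+ 4 = 1 ->
  chebA3 d (scale u w) = scale (u ^+ d) (chebA3 d w).
Proof.
move=> u4; have [t tt <-] := esym123_surj w; rewrite chebA3E //.
move: tt; have [a [b [c [e ->]]]] := tuple4_eta t => /torusE tt.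
have -> : scale u (esym123 [tuple a; b; c; e]) =
    esym123 [tuple u * a; u * b; u * c; u * e].
  by rewrite !esym123E; apply: val_inj => /=; congr [:: _; _; _]; ring.
rewrite chebA3E; last first.
  apply/torusE; transitivity (u ^+ 4 * (a * b * c * e)); first by ring.
  by rewrite u4 tt mul1r.
have tE x y z v : tpow d [tuple x; y; z; v] =
  [tuple x ^+ d; y ^+ d; z ^+ d; v ^+ d] by exact: val_inj.
rewrite !tE !esym123E; apply: val_inj => /=; rewrite !exprMn.
by congr [:: _; _; _]; ring.
Qed.

Let P_swap d w : chebA3 d (swap w) = swap (chebA3 d w).
Proof.
have [t tt <-] := esym123_surj w; rewrite chebA3E //.
move: tt; have [a [b [c [e ->]]]] := tuple4_eta t => /torusE tt.
have E x y z v : x * y * z * v = 1 ->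
    swap (esym123 [tuple x; y; z; v]) =
    esym123 [tuple y * z * v; x * z * v; x * y * v; x * y * z].
  move=> h; rewrite !esym123E; apply: val_inj => /=; congr [:: _; _; _].
  - by ring.
  - transitivity ((x * y * z * v) *
      (x * y + x * z + x * v + y * z + y * v + z * v)); last by ring.
    by rewrite h mul1r.
  - transitivity ((x * y * z * v) ^+ 2 * (x + y + z + v)); last by ring.
    by rewrite h expr1n mul1r.
have tE x y z v : tpow d [tuple x; y; z; v] =
  [tuple x ^+ d; y ^+ d; z ^+ d; v ^+ d] by exact: val_inj.
rewrite E // chebA3E; last first.
  apply/torusE; transitivity ((a * b * c * e) ^+ 3); first by ring.
  by rewrite tt expr1n.
by rewrite !tE E ?exprMn // -!exprMn tt expr1n.
Qed.

Let sum_prod (x y u v : C) : x + y = u + v -> x * y = u * v ->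
  (x = u /\ y = v) \/ (x = v /\ y = u).
Proof.
move=> hs hp; have /eqP : (x - u) * (x - v) = 0.
  transitivity (x ^+ 2 - (u + v) * x + u * v); first by ring.
  by rewrite -hs -hp; ring.
rewrite mulf_eq0 !subr_eq0 => /orP[] /eqP E; [left | right]; split=> //.
  by move: hs; rewrite E => /addrI.
by move: hs; rewrite E addrC => /addIr.
Qed.

Let H_fiber w w' : H w = H w' ->
  exists2 u, u ^+ 4 = 1 & w' = scale u w \/ w' = scale u (swap w).
Proof.
have [a [b [c ->]]] := tuple3_eta w; have [a' [b' [c' ->]]] := tuple3_eta w'.
move=> /(congr1 val)[]; set k := (_ + _) / 2; set k' := (_ + _) / 2.
move=> E1 E2 E3 E4.
have kE : a ^+ 2 + c ^+ 2 = 2 * k by rewrite /k; field.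
have kE' : a' ^+ 2 + c' ^+ 2 = 2 * k' by rewrite /k'; field.
have [[bE kk]|[bE kk]] : (b' = b /\ k' = k) \/ (b' = - b /\ k' = - k).
- have /orP[] : (b' == b) || (b' == - b) by rewrite -eqf_sqr E2.
    move=> /eqP bE; rewrite bE in E3 *.
    have [b0|b0] := eqVneq b 0; last by left; split=> //; apply: (mulfI b0).
    have /orP[] : (k' == k) || (k' == - k) by rewrite -eqf_sqr E4.
      by move=> /eqP ->; left.
    by move=> /eqP ->; right; rewrite b0 oppr0.
  move=> /eqP bE; rewrite bE in E3 *.
  have [b0|b0] := eqVneq b 0; last first.
    by right; split=> //; apply: (mulfI b0); rewrite mulrN E3 mulNr opprK.
  have /orP[] : (k' == k) || (k' == - k) by rewrite -eqf_sqr E4.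
    by move=> /eqP ->; left; rewrite b0 oppr0.
  by move=> /eqP ->; right.
- have /orP[] : (a' + c' == 1 * (a + c)) || (a' + c' == - (1 * (a + c))).
    rewrite -eqf_sqr mul1r !sqrrD; apply/eqP.
    transitivity ((a' ^+ 2 + c' ^+ 2) + 2 * (a' * c')); first by ring.
    by rewrite kE' kk -kE -E1; ring.
  + rewrite mul1r => /eqP hs; exists 1; first by rewrite expr1n.
    have [[-> ->]|[-> ->]] := sum_prod hs (esym E1); [left|right];
      by apply: val_inj; rewrite /= bE !expr1n !mul1r.
  + rewrite mul1r opprD => /eqP hs; exists (-1); first by ring.
    have hp : a' * c' = - a * - c by rewrite -E1; ring.
    have [[-> ->]|[-> ->]] := sum_prod hs hp; [left|right];
      apply: val_inj; rewrite /= bE; congr [:: _; _; _]; ring.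
- have ii : 'i ^+ 2 = -1 :> C by exact: sqrCi.
  have i4 : 'i ^+ 4 = 1 :> C by rewrite (exprM _ 2 2) ii; ring.
  have i3 : 'i ^+ 3 = - 'i :> C by rewrite exprS ii; ring.
  have /orP[] : (a' - c' == 'i * (a + c)) || (a' - c' == - ('i * (a + c))).
    rewrite -eqf_sqr exprMn ii; apply/eqP.
    transitivity ((a' ^+ 2 + c' ^+ 2) - 2 * (a' * c')); first by ring.
    transitivity (- ((a ^+ 2 + c ^+ 2) + 2 * (a * c))); last by ring.
    by rewrite kE' kk kE -E1; ring.
  + rewrite mulrDr => /eqP hs; exists 'i => //.
    have hp : a' * - c' = 'i * a * ('i * c).
      by transitivity ('i ^+ 2 * (a * c)); [rewrite ii E1 | ]; ring.
    have [[-> hc]|[-> hc]] := sum_prod hs hp; [left|right];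
      apply: val_inj; rewrite /= bE ii i3 -[c']opprK hc;
      by congr [:: _; _; _]; ring.
  + rewrite mulrDr opprD => /eqP hs; exists (- 'i).
      by transitivity ('i ^+ 4 : C); [ring | rewrite i4].
    have hp : a' * - c' = - ('i * a) * - ('i * c).
      by transitivity ('i ^+ 2 * (a * c)); [rewrite ii E1 | ]; ring.
    have ni2 : (- 'i) ^+ 2 = -1 :> C by rewrite sqrrN ii.
    have ni3 : (- 'i) ^+ 3 = 'i :> C by rewrite exprS ni2; ring.
    have [[-> hc]|[-> hc]] := sum_prod hs hp; [left|right];
      apply: val_inj; rewrite /= bE ni2 ni3 -[c']opprK hc;
      by congr [:: _; _; _]; ring.
Qed.

Lemma Ftilde_fd (d : nat) (v v' : 3.-tuple C) :
  Ftilde v = Ftilde v' -> Ftilde (fd d v) = Ftilde (fd d v').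
Proof.
rewrite -{1}(M3K v) -{1}(M3K v') !FM => /H_fiber[u u4].
have ud : (u ^+ d) ^+ 4 = 1 by rewrite exprAC u4 expr1n.
by case=> ->; rewrite P_scale // H_scale // P_swap H_swap.
Qed.

(* Only the values on XQ are relevant, see gd_unique. *)
Lemma exists_gd (d : nat) : exists h : 4.-tuple C -> 4.-tuple C,
  forall v, h (Ftilde v) = Ftilde (fd d v).
Proof.
pose pt w := xget [tuple 0; 0; 0] [set v | Ftilde v = w].
exists (fun w => Ftilde (fd d (pt w))) => v; apply: Ftilde_fd.
exact: (xgetPex _ (ex_intro [set v' | Ftilde v' = Ftilde v] v erefl)).
Qed.

Definition gd (d : nat) : 4.-tuple C -> 4.-tuple C := sval (cid (exists_gd d)).

Lemma gdE (d : nat) (v : 3.-tuple C) : gd d (Ftilde v) = Ftilde (fd d v).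
Proof. exact: (svalP (cid (exists_gd d))). Qed.

Lemma gd_unique (d : nat) (h : 4.-tuple C -> 4.-tuple C) :
  (forall v, h (Ftilde v) = Ftilde (fd d v)) -> forall w, XQ w -> h w = gd d w.
Proof. by rewrite -range_Ftilde => hE _ [v _ <-]; rewrite hE gdE. Qed.

Lemma gd_XQ (d : nat) (w : 4.-tuple C) : XQ w -> XQ (gd d w).
Proof. by rewrite -range_Ftilde => -[v _ <-]; rewrite gdE; exists (fd d v). Qed.

End QuotientMap.

Arguments XQ C : clear implicits.
Arguments L2 C : clear implicits.
Arguments C2 C : clear implicits.

(* Main.v *)
Require Import Defs.
From mathcomp Require Import all_boot all_order all_algebra.
From mathcomp Require Import boolp classical_sets reals.
From mathcomp Require Import complex mpoly.
From mathcomp Require Import ring.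

Import GRing.Theory Num.Theory.
Local Open Scope classical_set_scope.
Local Open Scope ring_scope.

(** [Ftilde \o M3inv \o esym123] maps the torus onto [XQ] and conjugates
    [tpow d] to [gd d].  It sends [(a, -a, 1/a, -1/a)] to the point of [L2] with
    [q = t^2], where [s = a^2] and [t = s + 1/s], and it sends [(s, s, 1/s, 1/s)]
    to [G2 (t^2)].  Odd powers preserve the first shape, squaring turns the first
    shape into the second, and all powers preserve the second.  Since [C2] is the
    image of [G2], polynomials on [C2] pull back to polynomials in one variable,
    whose zero sets are finite; this gives irreducibility and dimension 1. *)

(** * Algebraic sets and one-variable pullbacks *)

Section ZeroSets.
Context {C : numClosedFieldType}.

(** [mmap polyC ps f] is the pullback of [f] to the parameter line; it turns questions about a
    parametrized curve into questions in [{poly C}]. *)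
Lemma meval_hornerE n (ps : 'I_n -> {poly C}) (f : {mpoly C[n]}) T :
  (mmap polyC ps f).[T] = f.@[fun i => (ps i).[T]].
Proof.
rewrite /meval /mmap horner_sum; apply: eq_bigr => m _.
rewrite hornerM hornerC /mmap1 horner_prod; congr (_ * _).
by apply: eq_bigr => i _; rewrite horner_exp.
Qed.

Lemma horner_eq0 (h : {poly C}) : (forall T, h.[T] = 0) -> h = 0.
Proof.
move=> h0; apply/eqP; apply: contraT => /closed_nonrootP[x].
by rewrite /root h0 eqxx.
Qed.

Lemma algebraicI {n} {A B : set (n.-tuple C)} :
  algebraic A -> algebraic B -> algebraic (A `&` B).
Proof.
move=> [S ->] [S' ->]; exists (S `|` S'); apply/seteqP; split=> v.
  by move=> [vS vS'] f [/vS|/vS'].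
by move=> vSS'; split=> f fS; apply: vSS'; [left|right].
Qed.

Lemma algebraic_hypersurface {n} (f : {mpoly C[n]}) :
  algebraic [set v : n.-tuple C | f.@[tnth v] = 0].
Proof. by exists [set f]; apply/seteqP; split=> v /= => [fv _ ->|->]. Qed.

Lemma algebraic_point n (v : n.-tuple C) : algebraic [set v].
Proof.
exists [set 'X_i - (tnth v i)%:MP | i in setT].
apply/seteqP; split=> [_ -> _ [i _ <-]|w wv].
  by rewrite mevalB mevalXU mevalC subrr.
apply: eq_from_tnth => i.
have := wv _ (ex_intro2 _ _ i I erefl).
by rewrite mevalB mevalXU mevalC => /subr0_eq.
Qed.

Lemma irreducible_point n (v : n.-tuple C) : irreducible [set v].
Proof.
split; [exact: algebraic_point|by exists v|move=> A B _ _ vAB].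
have : [set v] v by [].
rewrite [X in X v]vAB => -[Av|Bv]; [left|right]; apply/seteqP; split=> w.
- by move=> ->.
- by move=> Aw; rewrite vAB; left.
- by move=> ->.
- by move=> Bw; rewrite vAB; right.
Qed.

Lemma algebraic_not_sub {n} {A : set (n.-tuple C)} {v} : algebraic A -> ~ A v ->
  exists2 f : {mpoly C[n]}, (forall w, A w -> f.@[tnth w] = 0) & f.@[tnth v] != 0.
Proof.
move=> [S ->] /existsNP[f] /not_implyP[Sf fv]; exists f; last exact/eqP.
by move=> w; apply.
Qed.

(** * Irreducibility and dimension of polynomially parametrized curves *)

Section PolynomialCurve.
Context {n : nat} {G : C -> n.-tuple C} {ps : 'I_n -> {poly C}}.
Hypothesis G_poly : forall T i, tnth (G T) i = (ps i).[T].

Lemma meval_curve f T : f.@[tnth (G T)] = (mmap polyC ps f).[T].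
Proof. by rewrite meval_hornerE; apply: meval_eq => i; rewrite G_poly. Qed.

(** If neither [A] nor [B] covers the curve, some [f] vanishing on [A] and some [g] vanishing on [B]
    have nonzero pullbacks. Their product vanishes at every parameter, which is absurd in the
    integral domain [{poly C}]. *)
Lemma irreducible_range : algebraic (range G) -> irreducible (range G).
Proof.
move=> Galg; split=> //; first by exists (G 0), 0.
move=> A B Aalg Balg GAB.
have [GA|/existsNP[v /not_implyP[[a _ <-] nA]]] := pselect (range G `<=` A).
  by left; apply/seteqP; split=> // w Aw; rewrite GAB; left.
have [GB|/existsNP[v' /not_implyP[[b _ <-] nB]]] := pselect (range G `<=` B).
  by right; apply/seteqP; split=> // w Aw; rewrite GAB; right.
have [f fA] := algebraic_not_sub Aalg nA.
have [g gB] := algebraic_not_sub Balg nB.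
rewrite !meval_curve => gb fa.
have /eqP : mmap polyC ps f * mmap polyC ps g = 0.
  apply: horner_eq0 => T; rewrite hornerM -!meval_curve.
  have : range G (G T) by exists T.
  by rewrite GAB => -[/fA|/gB] ->; rewrite ?mul0r ?mulr0.
by rewrite mulf_eq0 => /orP[]/eqP h0; move: gb fa; rewrite h0 horner0 eqxx.
Qed.

(* A proper algebraic subset of the curve is finite; if [Z1] contained a point
   [G a] of [Z0] and another one, it would split into the fibre of [k] over
   [k (G a)] and the union of the finitely many remaining fibres. *)
Lemma no_chain2_range (k : {mpoly C[n]}) :
  (forall T T', k.@[tnth (G T)] = k.@[tnth (G T')] -> T = T') ->
  ~ has_chain (range G) 2.
Proof.
move=> k_inj [Z [Zirr Zlt]].
have [[Z0alg [v0 Z0v0] _] _] := Zirr 0 isT.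
have [[Z1alg _ Z1irr] Z1G] := Zirr 1 isT.
have [Z01 [v1 Z1v1 nZ0v1]] : Z 0 `<=` Z 1 /\ exists2 v, Z 1 v & ~ Z 0 v.
  by have [le /nonsubset[v []]] := Zlt 0 isT; split=> //; exists v.
have [v2 [Z2v2 nZ1v2]] : exists v, Z 2 v /\ ~ Z 1 v.
  by have [_ /nonsubset] := Zlt 1 isT.
have [a _ Ga] : range G v0 by exact/Z1G/Z01.
have [b _ Gb] : range G v1 by exact/Z1G.
have [c _ Gc] : range G v2 by have [_] := Zirr 2 isT; apply.
have [f fZ] := algebraic_not_sub Z1alg nZ1v2.
rewrite -Gc meval_curve => fc.
have h_neq0 : mmap polyC ps f != 0.
  by apply: contra_neq fc => ->; rewrite horner0.
have [rs Ers] := closed_field_poly_normal (mmap polyC ps f).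
pose m : {mpoly C[n]} := \prod_(x <- rs | x != a) (k - k.@[tnth (G x)]%:MP).
have mE v : m.@[tnth v] =
    \prod_(x <- rs | x != a) (k.@[tnth v] - k.@[tnth (G x)]).
  by rewrite rmorph_prod; apply: eq_bigr => x _; rewrite /= mevalB mevalC.
pose l : {mpoly C[n]} := k - k.@[tnth (G a)]%:MP.
have lE v : l.@[tnth v] = k.@[tnth v] - k.@[tnth (G a)].
  by rewrite mevalB mevalC.
have := Z1irr _ _ (algebraicI Z1alg (algebraic_hypersurface l))
                  (algebraicI Z1alg (algebraic_hypersurface m)).
case.
- apply/seteqP; split=> [v Z1v|v [[]|[]] //].
  have [T _ GT] := Z1G _ Z1v; rewrite -GT in Z1v *; have /eqP := fZ _ Z1v.
  rewrite meval_curve Ers hornerZ mulf_eq0 lead_coef_eq0 (negPf h_neq0) /=.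
  rewrite -/(root _ T) root_prod_XsubC => T_rs.
  have [Ta|Ta] := eqVneq T a.
    by left; split; rewrite //= lE Ta subrr.
  right; split; rewrite //= mE; apply/eqP; rewrite prodf_seq_eq0.
  by apply/hasP; exists T; rewrite // Ta subrr eqxx.
- move=> Z1l; apply: nZ0v1; move: Z1v1; rewrite Z1l -Gb => -[_ /=].
  by rewrite lE => /subr0_eq/k_inj ->; rewrite Ga.
- move=> Z1m; have /Z01 := Z0v0; rewrite Z1m -Ga => -[_ /=].
  move=> /eqP; rewrite mE prodf_seq_eq0 => /hasP[x _ /andP[xa]].
  by rewrite subr_eq0 => /eqP/k_inj ax; rewrite ax eqxx in xa.
Qed.

Lemma affine_algebraic_curve_range (k : {mpoly C[n]}) :
  (forall T T', k.@[tnth (G T)] = k.@[tnth (G T')] -> T = T') ->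
  algebraic (range G) -> affine_algebraic_curve (range G).
Proof.
move=> k_inj Galg; have Girr := irreducible_range Galg.
split=> //; split; last exact: no_chain2_range k_inj.
(* The chain is a point inside the curve; it is strict because [k] separates [G 1] from [G 0]. *)
exists (fun i => if i is 0 then [set G 0] else range G); split.
  move=> [|i] _; split=> //; first exact: irreducible_point.
  by move=> _ ->; exists 0.
move=> [|//] _; split=> [_ ->|]; first by exists 0.
move=> /(_ (G 1)) G10; have {}G10 : G 1 = G 0 by apply: G10; exists 1.
have /eqP := k_inj 1 0 (congr1 (fun v => k.@[tnth v]) G10).
by rewrite oner_eq0.
Qed.

End PolynomialCurve.
End ZeroSets.

(** * The action of [gd] computed on torus points *)

Section ChebyshevDynamics.
Context {C : numClosedFieldType}.

Lemma add_inv_surj (t : C) : exists2 s, s != 0 & s + s^-1 = t.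
Proof.
(* [s] and its inverse are the two roots of [X^2 - t X + 1]. *)
pose w := sqrtC (t ^+ 2 - 4).
have sv : (t + w) / 2 * ((t - w) / 2) = 1.
  transitivity ((t ^+ 2 - w ^+ 2) / 4); first by field.
  by rewrite sqrtCK; field.
have s0 : (t + w) / 2 != 0.
  by apply: contra_eq_neq sv => ->; rewrite mul0r eq_sym oner_eq0.
exists ((t + w) / 2) => //.
have -> : ((t + w) / 2)^-1 = (t - w) / 2 by apply: (mulfI s0); rewrite sv divff.
by field.
Qed.

Lemma chebT_surj d (t : C) : (0 < d)%N -> exists u, (chebT C d).[u] = t.
Proof.
move=> d0; have [s s0 <-] := add_inv_surj t.
have r0 : d.-root s != 0 by rewrite rootC_eq0.
exists (d.-root s + (d.-root s)^-1).
by rewrite chebTE // -exprVn rootCK // exprVn rootCK.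
Qed.

Lemma Ftilde_M3inv (a b c : C) : Ftilde (M3inv [tuple a; b; c]) =
  [tuple a * c; b ^+ 2; b * ((a ^+ 2 + c ^+ 2) / 2);
         ((a ^+ 2 + c ^+ 2) / 2) ^+ 2].
Proof.
apply: val_inj => /=.
(* [field] does not know that ['i ^+ 2 = -1], so ['i] is eliminated first. *)
have -> : ((a - c) / (2 * 'i)) ^+ 2 = - (a - c) ^+ 2 / 4.
  rewrite expr_div_n exprMn sqrCi mulrN1 invrN mulrN mulNr.
  by congr (- (_ * _^-1)); ring.
by congr [:: _; _; _; _]; field.
Qed.

Lemma gd_esym123 d (t : 4.-tuple C) : torus t ->
  gd d (Ftilde (M3inv (esym123 t))) = Ftilde (M3inv (esym123 (tpow d t))).
Proof. by move=> tt; rewrite gdE /fd M3invK chebA3E. Qed.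

Lemma tpow4 d (a b c e : C) :
  tpow d [tuple a; b; c; e] = [tuple a ^+ d; b ^+ d; c ^+ d; e ^+ d].
Proof. exact: val_inj. Qed.

(** The entries are permuted by negation, so [e1 = e3 = 0], while [e2 = -(a^2 + a^-2)]; only the
    coordinate [q] survives. *)
Lemma L2_esym123 (a : C) : a != 0 ->
  Ftilde (M3inv (esym123 [tuple a; - a; a^-1; - a^-1])) =
  [tuple 0; (a ^+ 2 + a ^- 2) ^+ 2; 0; 0].
Proof.
move=> a0; rewrite esym123E Ftilde_M3inv; apply: val_inj => /=.
by congr [:: _; _; _; _]; field.
Qed.

(** With [t = s + 1/s], one finds [e1 = e3 = 2t] and [e2 = t^2 + 2]. *)
Lemma G2_esym123 (s : C) : s != 0 ->
  Ftilde (M3inv (esym123 [tuple s; s; s^-1; s^-1])) = G2 ((s + s^-1) ^+ 2).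
Proof.
move=> s0; rewrite esym123E Ftilde_M3inv; apply: val_inj => /=.
by congr [:: _; _; _; _]; field.
Qed.

Lemma torus_L2 (a : C) : a != 0 -> torus [tuple a; - a; a^-1; - a^-1].
Proof. by move=> a0; apply/torusE; field. Qed.

Lemma torus_G2 (s : C) : s != 0 -> torus [tuple s; s; s^-1; s^-1].
Proof. by move=> s0; apply/torusE; field. Qed.

Lemma gd_L2_odd d (t : C) : odd d ->
  gd d [tuple 0; t ^+ 2; 0; 0] = [tuple 0; (chebT C d).[t] ^+ 2; 0; 0].
Proof.
move=> d_odd; have [s s0 <-] := add_inv_surj t; rewrite chebTE //.
have [a as2] : exists a, a ^+ 2 = s by exists (sqrtC s); rewrite sqrtCK.
have a0 : a != 0 by apply: contra_neq s0 => a0; rewrite -as2 a0 expr0n.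
rewrite -as2 -L2_esym123 // gd_esym123; last exact: torus_L2.
(* As [d] is odd, the powers again have the form [(b, -b, 1/b, -1/b)], now with [b = a ^+ d] and
   [b ^+ 2 = s ^+ d]. *)
rewrite tpow4 [(- a) ^+ d]exprNn [(- a^-1) ^+ d]exprNn -signr_odd d_odd !mulN1r.
by rewrite exprVn L2_esym123 ?expf_neq0 // -!exprM mulnC.
Qed.

Lemma gd2_L2 (t : C) : gd 2 [tuple 0; t ^+ 2; 0; 0] = G2 (t ^+ 2).
Proof.
have [s s0 <-] := add_inv_surj t.
have [a as2] : exists a, a ^+ 2 = s by exists (sqrtC s); rewrite sqrtCK.
have a0 : a != 0 by apply: contra_neq s0 => a0; rewrite -as2 a0 expr0n.
rewrite -as2 -L2_esym123 // gd_esym123; last exact: torus_L2.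
by rewrite tpow4 !sqrrN exprVn G2_esym123 // expf_neq0.
Qed.

Lemma gd_G2 d (t : C) : gd d (G2 (t ^+ 2)) = G2 ((chebT C d).[t] ^+ 2).
Proof.
have [s s0 <-] := add_inv_surj t; rewrite chebTE // -G2_esym123 //.
rewrite gd_esym123; last exact: torus_G2.
by rewrite tpow4 exprVn G2_esym123 // expf_neq0.
Qed.

(** Every complex number is a square, so the formulas for [gd] at [t ^+ 2] reach all of [L2];
    [range_G2_sqr] does the same for [C2]. *)
Lemma L2E_sqr : L2 C = range (fun t => [tuple 0; t ^+ 2; 0; 0]).
Proof.
rewrite L2E; apply/seteqP; split=> _ [q _ <-]; last by exists (q ^+ 2).
by exists (sqrtC q); rewrite // sqrtCK.
Qed.

Lemma range_G2_sqr : range (@G2 C) = range (fun t => G2 (t ^+ 2)).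
Proof.
apply/seteqP; split=> _ [q _ <-]; last by exists (q ^+ 2).
by exists (sqrtC q); rewrite // sqrtCK.
Qed.

(** * The curve [C2] and its parametrization *)

Lemma C2E : C2 C = range (@G2 C).
Proof.
apply/seteqP; split=> w.
  have [p [q [r [s ->]]]] := tuple4_eta w => H.
  have := (H _ (or_introl (or_introl erefl)), H _ (or_introl (or_intror erefl)),
           H _ (or_intror erefl)).
  rewrite !(rmorph_nat, rmorphD, rmorphN, rmorphM, rmorphXn) /=.
  rewrite !mevalXU !(tnth_nth 0) /= => -[[E1 E2] E3].
  (* [E3] reads [(4r - s)^2 = 64 s] and [E2] reads [4r - s = 8p]. Then [E2] gives [r] and [E1] gives
     [q] in terms of [p], and the parameter is [p / 4] since the first coordinate of [G2 T] is
     [4 T]. *)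
  have sE : s = p ^+ 2.
    apply: (@mulfI _ 64); first by rewrite pnatr_eq0.
    apply: subr0_eq; rewrite -[RHS]oppr0 -E3.
    have -> : p = (4 * r - s) / 8.
      by apply: subr0_eq; rewrite -[RHS](mul0r (- 8^-1)) -E2; field.
    by field.
  have rE : r = 2 * p + p ^+ 2 / 4.
    by apply: subr0_eq; rewrite -[RHS](mul0r 4^-1) -E2 sE; field.
  exists (p / 4) => //; apply: val_inj => /=; congr [:: _; _; _; _].
  - by field.
  - by apply: subr0_eq; rewrite -[RHS](mul0r (- 16^-1)) -E1 rE sE; field.
  - by rewrite rE; field.
  - by rewrite sE; field.
case=> T _ <- _ [[]|] ->;
  rewrite !(rmorph_nat, rmorphD, rmorphN, rmorphM, rmorphXn) /=;
  by rewrite !mevalXU !(tnth_nth 0) /=; ring.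
Qed.

Definition G2_poly : 4.-tuple {poly C} :=
  [tuple 4 * 'X; ('X + 2) ^+ 2; 4 * 'X * ('X + 2); 16 * 'X ^+ 2].

Lemma G2_polyE T i : tnth (G2 T) i = (tnth G2_poly i).[T].
Proof.
by case: i => [[|[|[|[|//]]]] ?]; rewrite (tnth_nth 0) [in RHS](tnth_nth 0) /=;
  rewrite -!polyC_natr !hornerE.
Qed.

Lemma algebraic_C2 : algebraic (C2 C). Proof. by eexists. Qed.

Lemma affine_algebraic_curve_C2 : affine_algebraic_curve (C2 C).
Proof.
(* The first coordinate [4 T] already determines [T], so it serves as [k]. *)
rewrite C2E; apply: (affine_algebraic_curve_range G2_polyE 'X_ord0).
  move=> T T'; rewrite !mevalXU !(tnth_nth 0) /=.
  by apply: mulfI; rewrite pnatr_eq0.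
by rewrite -C2E; exact: algebraic_C2.
Qed.

(** The image is all of [C2], so minimality among algebraic sets is immediate. *)
Lemma polynomial_param_G2 :
  polynomial_param (fun u : 1.-tuple C => G2 (thead u)) (C2 C).
Proof.
have GE : range (fun u : 1.-tuple C => G2 (thead u)) = C2 C.
  rewrite C2E; apply/seteqP; split=> _ [u _ <-]; first by exists (thead u).
  by exists [tuple u].
split; rewrite ?GE //; last exact: algebraic_C2.
(* Each one-variable polynomial is moved to [{mpoly C[1]}] by evaluating it at the variable
   ['X_ord0]. *)
exists (map_tuple (fun h => (map_poly (@mpolyC 1 C) h).['X_ord0]) G2_poly).
move=> u i; rewrite tnth_map G2_polyE -horner_map -map_poly_comp /= mevalXU.
by congr horner; rewrite map_poly_id // => c _; rewrite /= mevalC.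
Qed.

End ChebyshevDynamics.

Theorem proposition4p19 (R : realType) :
  (forall d : nat, odd d ->
     gd d @` L2 (CC R) = L2 (CC R) /\
     forall t : CC R,
       gd d [tuple 0; t ^+ 2; 0; 0] = [tuple 0; (chebT (CC R) d).[t] ^+ 2; 0; 0]) /\
  (gd 2 @` L2 (CC R) = C2 (CC R) /\
   affine_algebraic_curve (C2 (CC R)) /\
   polynomial_param (fun u : 1.-tuple (CC R) => G2 (thead u)) (C2 (CC R))) /\
  (forall d : nat, (1 <= d)%N ->
     gd d @` C2 (CC R) = C2 (CC R) /\
     forall t : CC R,
       gd d (G2 (t ^+ 2)) = G2 ((chebT (CC R) d).[t] ^+ 2)).
Proof.
split; [|split].
- move=> d d_odd; split=> [|t]; last exact: gd_L2_odd.
  rewrite L2E_sqr; apply/seteqP; split=> [_ [_ [t _ <-] <-]|_ [t _ <-]].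
    by rewrite gd_L2_odd //; exists (chebT (CC R) d).[t].
  (* Surjectivity of [gd d] on [L2] comes from that of the Chebyshev polynomial on [C], where
     [d > 0] is used to extract a [d]-th root. *)
  have [u <-] := @chebT_surj (CC R) d t (odd_gt0 d_odd).
  by exists [tuple 0; u ^+ 2; 0; 0]; [exists u|exact: gd_L2_odd].
- split; last first.
    by split; [exact: affine_algebraic_curve_C2|exact: polynomial_param_G2].
  rewrite L2E_sqr C2E range_G2_sqr.
  apply/seteqP; split=> [_ [_ [t _ <-] <-]|_ [t _ <-]].
    by rewrite gd2_L2; exists t.
  by exists [tuple 0; t ^+ 2; 0; 0]; [exists t|exact: gd2_L2].
- move=> d d_gt0; split=> [|t]; last exact: gd_G2.
  rewrite C2E range_G2_sqr.
  apply/seteqP; split=> [_ [_ [t _ <-] <-]|_ [t _ <-]].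
    by rewrite gd_G2; exists (chebT (CC R) d).[t].
  have [u <-] := @chebT_surj (CC R) d t d_gt0.
  by exists (G2 (u ^+ 2)); [exists u|exact: gd_G2].
Qed.
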